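(* There is a tight simplex of $12$ points in $\mathbb{H}\mathbb{P}^2$. In fact, there is such a tight simplex with cyclic symmetry, i.e., one such that whenever the point represented by $(x,y,z)\in\mathbb{H}^3$ belongs to it, so do the points represented by $(y,z,x)$ and $(z,x,y)$, and these are three distinct points of $\mathbb{H}\mathbb{P}^2$.
   Context: $\mathbb{H}\mathbb{P}^2$ is the space of quaternionic lines in $\mathbb{H}^3$ (scalars acting on the right), points represented by unit vectors, with $\langle x,y\rangle = x^\dagger y$. A tight simplex of $N$ points in $\mathbb{H}\mathbb{P}^{2}$ is a set of $N$ distinct points $x_1,\dots,x_N$ with $|\langle x_i,x_j\rangle|^2=\frac{N-3}{3(N-1)}$ for all $i\ne j$. *)

(* Defs.v *)
From HB Require Import structures.
From mathcomp Require Import all_boot all_order all_algebra.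
From mathcomp Require Import reals.
Set Implicit Arguments. Unset Strict Implicit. Unset Printing Implicit Defensive.
Import Order.TTheory GRing.Theory Num.Theory.
Local Open Scope ring_scope.

Record quat (R : realType) := Quat { qa : R; qb : R; qc : R; qd : R }.

Section Quat.
Variable R : realType.

Definition qzero : quat R := Quat 0 0 0 0.
Definition qadd (p q : quat R) : quat R :=
  Quat (qa p + qa q) (qb p + qb q) (qc p + qc q) (qd p + qd q).
Definition qmul (p q : quat R) : quat R :=
  Quat (qa p * qa q - qb p * qb q - qc p * qc q - qd p * qd q)
       (qa p * qb q + qb p * qa q + qc p * qd q - qd p * qc q)
       (qa p * qc q - qb p * qd q + qc p * qa q + qd p * qb q)
       (qa p * qd q + qb p * qc q - qc p * qb q + qd p * qa q).
Definition qconj (p : quat R) : quat R := Quat (qa p) (- qb p) (- qc p) (- qd p).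
Definition qnorm2 (p : quat R) : R := qa p ^+ 2 + qb p ^+ 2 + qc p ^+ 2 + qd p ^+ 2.

Definition hvec := 'I_3 -> quat R.

Definition hip (x y : hvec) : quat R := \big[qadd/qzero]_(i < 3) qmul (qconj (x i)) (y i).

Definition unit_vec (x : hvec) : Prop := \sum_(i < 3) qnorm2 (x i) = 1.

(* x and y span the same quaternionic line (scalars acting on the right),
   i.e. they represent the same point of HP^2 *)
Definition same_line (x y : hvec) : Prop := exists q : quat R, forall i, x i = qmul (y i) q.

Definition tight_simplex (N : nat) (x : 'I_N -> hvec) : Prop :=
  (forall i, unit_vec (x i)) /\
  (forall i j, i != j -> ~ same_line (x i) (x j)) /\
  (forall i j, i != j ->
     qnorm2 (hip (x i) (x j)) = (N%:R - 3) / (3 * (N%:R - 1))).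

Definition cyc (v : hvec) : hvec := fun i => v (inord ((i + 1) %% 3)%N).

Definition cyclic_symmetric (N : nat) (x : 'I_N -> hvec) : Prop :=
  forall i,
    (exists j, same_line (cyc (x i)) (x j)) /\
    (exists k, same_line (cyc (cyc (x i))) (x k)) /\
    ~ same_line (x i) (cyc (x i)) /\
    ~ same_line (x i) (cyc (cyc (x i))) /\
    ~ same_line (cyc (x i)) (cyc (cyc (x i))).
End Quat.

(* Main.v *)
Require Import Defs.
From HB Require Import structures.
From mathcomp Require Import all_boot all_order all_algebra.
From mathcomp Require Import reals.
From mathcomp Require Import classical_sets functions interval_inference.
From mathcomp Require Import topology normedtype sequences.
From Stdlib Require Import BinInt.
From mathcomp Require Import ssrZ zify ring lra.
Set Implicit Arguments. Unset Strict Implicit.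
Unset Printing Implicit Defensive.
Import Order.TTheory GRing.Theory Num.Theory numFieldNormedType.Exports.
Delimit Scope nat_scope with N.
Local Open Scope ring_scope.

(* The simplex consists of the orbits of four vectors y_0, ..., y_3 under the
   cyclic shift c, so there are 22 conditions |<y_a, c^k y_b>|^2 = 3/11.  Their
   Jacobian is singular at every solution: with
   C(y) = sum_i y_i conj(y_{i+1}), a quaternion, one has
     sum_k |<x, c^k y>|^2 = |x|^2 |y|^2 + 2 Re(conj(C(x)) C(y)),
   so the conditions make the C(y_a) a regular simplex inscribed in a sphere
   centered at 0, hence sum_a C(y_a) = 0, and this equation only enters through
   the square of its left-hand side.  Imposing sum_a C(y_a) = 0 explicitly and
   dropping the four conditions that it implies leaves, with |y_a| = 1, a
   nondegenerate system of 26 polynomial equations in 48 unknowns.  A solution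
   exists near a numerical one by the contraction principle, applied to a Newton
   map whose Lipschitz constant is bounded by integer interval arithmetic. *)

(** Completeness of row vector spaces, required by the contraction principle. *)
HB.instance Definition _ (R : realType) m n := Complete.on 'M[R]_(m, n).

(** * Integer interval arithmetic and its soundness over the reals *)

Section IntegersInReals.
Variable R : realType.

Definition ZR (z : Z) : R := (int_of_Z z)%:~R.

Lemma ZRD a b : ZR (a + b)%Z = ZR a + ZR b.
Proof. by rewrite /ZR (rmorphD int_of_Z) rmorphD. Qed.

Lemma ZRN a : ZR (- a)%Z = - ZR a.
Proof. by rewrite /ZR (rmorphN int_of_Z) rmorphN. Qed.

Lemma ZRM a b : ZR (a * b)%Z = ZR a * ZR b.
Proof. by rewrite /ZR (rmorphM int_of_Z) rmorphM. Qed.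

Lemma ZR_le a b : (a <= b)%Z -> ZR a <= ZR b.
Proof. by move=> ab; rewrite /ZR ler_int; lia. Qed.

Lemma ZR_abs z : ZR (Z.abs z) = `|ZR z|.
Proof.
rewrite /ZR -intr_norm; congr (_%:~R); lia.
Qed.

End IntegersInReals.

Definition ival := (Z * Z)%type.
Definition ipoint (z : Z) : ival := (z, z).
Definition iadd (I J : ival) : ival := (I.1 + J.1, I.2 + J.2)%Z.
Definition iopp (I : ival) : ival := (- I.2, - I.1)%Z.
Definition imul (I J : ival) : ival :=
  let a := (I.1 * J.1)%Z in let b := (I.1 * J.2)%Z in
  let c := (I.2 * J.1)%Z in let d := (I.2 * J.2)%Z in
  (Z.min (Z.min a b) (Z.min c d), Z.max (Z.max a b) (Z.max c d)).
Definition iabs (I : ival) : Z := Z.max (Z.abs I.1) (Z.abs I.2).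

Section IntervalSoundness.
Variable R : realType.
Implicit Types (x y : R) (I J : ival).

Definition inI x I := ZR R I.1 <= x <= ZR R I.2.

Lemma inI_point z : inI (ZR R z) (ipoint z).
Proof. by rewrite /inI lexx. Qed.

Lemma inI_add x y I J : inI x I -> inI y J -> inI (x + y) (iadd I J).
Proof. by rewrite /inI !ZRD => /andP[? ?] /andP[? ?]; rewrite !lerD. Qed.

Lemma inI_opp x I : inI x I -> inI (- x) (iopp I).
Proof. by rewrite /inI !ZRN !lerN2 andbC. Qed.

(** A product is affine in each factor, so on a rectangle it is smallest at a corner; the signs of
    [e] and [y] select the endpoints. *)
Lemma mul_ge_corners (x y a b c d l : R) :
  a <= x <= b -> c <= y <= d ->
  l <= a * c -> l <= a * d -> l <= b * c -> l <= b * d -> l <= x * y.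
Proof.
move=> /andP[ax xb] /andP[cy yd] lac lad lbc lbd.
have edge e : l <= e * c -> l <= e * d -> l <= e * y.
  move=> lc ld; have [e0|e0] := leP 0 e.
    exact: le_trans lc (ler_wpM2l e0 cy).
  exact: le_trans ld (ler_wnM2l (ltW e0) yd).
have [y0|y0] := leP 0 y.
  exact: le_trans (edge a lac lad) (ler_wpM2r y0 ax).
exact: le_trans (edge b lbc lbd) (ler_wnM2r (ltW y0) xb).
Qed.

Lemma inI_mul x y I J : inI x I -> inI y J -> inI (x * y) (imul I J).
Proof.
case: I J => [a b] [c d] xI yJ; apply/andP; split.
  by apply: (mul_ge_corners xI yJ); rewrite -ZRM; apply: ZR_le => /=; lia.
rewrite -lerN2 -mulNr.
by apply: (mul_ge_corners (inI_opp xI) yJ);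
  rewrite -ZRM -ZRN; apply: ZR_le => /=; lia.
Qed.

Lemma inI_abs x I : inI x I -> `|x| <= ZR R (iabs I).
Proof.
case: I => [a b] /andP[/= ax xb]; rewrite ler_norml -ZRN.
rewrite (le_trans _ ax) ?(le_trans xb) //; apply: ZR_le; rewrite /iabs /=; lia.
Qed.

End IntervalSoundness.

(** * Polynomial expressions with enclosures of values and slopes *)

Inductive expr :=
| Var of nat
| Cst of Z
| Opp of expr
| Add of expr & expr
| Mul of expr & expr.

Fixpoint eval (R : realType) (v : nat -> R) (e : expr) : R :=
  match e with
  | Var i => v i
  | Cst z => ZR R z
  | Opp e => - eval v e
  | Add e f => eval v e + eval v f
  | Mul e f => eval v e * eval v f
  end.

Section Certificate.
Variables (n : nat) (c : seq Z) (A : seq (seq Z)).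

Definition coef (i j : nat) : Z := nth 0%Z (nth [::] A i) j.
(** The largest deviation of coordinate [i] from [c] over the cube; missing entries of [A] count as
    zero. *)
Definition radius (i : nat) : Z :=
  foldr (fun j s => (Z.abs (coef i j) + s)%Z) 0%Z (iota 0 n).

Definition zipop (f : ival -> ival -> ival) (s t : seq ival) : seq ival :=
  [seq f p.1 p.2 | p <- zip s t].

(* Encloses the values of an expression on the parallelepiped
   [c + A [-1, 1]^n] together with slopes with respect to the parameter in
   [-1, 1]^n, i.e. coefficients m_j such that
   e(u) - e(w) = \sum_j m_j (u_j - w_j). *)
Fixpoint enclose (e : expr) : ival * seq ival :=
  match e with
  | Var i =>
      let ci := nth 0%Z c i in let r := radius i in
      ((ci - r, ci + r)%Z, mkseq (fun j => ipoint (coef i j)) n)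
  | Cst z => (ipoint z, nseq n (ipoint 0))
  | Opp e => let: (a, s) := enclose e in (iopp a, map iopp s)
  | Add e f =>
      let: (a, s) := enclose e in let: (b, t) := enclose f in
      (iadd a b, zipop iadd s t)
  | Mul e f =>
      let: (a, s) := enclose e in let: (b, t) := enclose f in
      (imul a b, zipop iadd [seq imul x b | x <- s] [seq imul a y | y <- t])
  end.

Fixpoint evalZ (v : nat -> Z) (e : expr) : Z :=
  match e with
  | Var i => v i
  | Cst z => z
  | Opp e => (- evalZ v e)%Z
  | Add e f => (evalZ v e + evalZ v f)%Z
  | Mul e f => (evalZ v e * evalZ v f)%Z
  end.

(* The slope matrix is within rho / 2 of rho times the identity in the row sum
   norm, and the residual at the center is at most rho / 2. *)
Definition certified (rho : Z) (k : nat) (e : expr) : bool :=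
  let s := (enclose e).2 in
  (2 * foldr (fun j t =>
         iabs (iadd (nth (ipoint 0) s j)
                    (iopp (ipoint (if j == k then rho else 0)))) + t)
       0 (iota 0 n) <=? rho)%Z
  && (2 * Z.abs (evalZ (nth 0 c) e) <=? rho)%Z.

Section Soundness.
Variable R : realType.
Implicit Types u w : 'rV[R]_n.

Definition point u (i : nat) : R :=
  ZR R (nth 0%Z c i) + \sum_(j < n) ZR R (coef i j) * u 0 j.

Lemma ZR_foldr (F : nat -> Z) :
  ZR R (foldr (fun j s => (F j + s)%Z) 0%Z (iota 0 n)) =
  \sum_(j < n) ZR R (F j).
Proof.
rewrite -(big_mkord xpredT (fun j => ZR R (F j))) /index_iota subn0.
by elim: (iota 0 n) => [|j s IH]; rewrite ?big_nil // big_cons /= ZRD IH.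
Qed.

Lemma eval_point0 e : eval (point 0) e = ZR R (evalZ (nth 0%Z c) e).
Proof.
elim: e => [i|z|e IH|e IHe f IHf|e IHe f IHf] //=.
- by rewrite /point big1 ?addr0 // => j _; rewrite mxE mulr0.
- by rewrite IH ZRN.
- by rewrite IHe IHf ZRD.
- by rewrite IHe IHf ZRM.
Qed.

Lemma size_enclose e : size (enclose e).2 = n.
Proof.
elim: e => [i|z|e IH|e IHe f IHf|e IHe f IHf] /=.
- exact: size_mkseq.
- exact: size_nseq.
- by case: (enclose e) IH => I s /=; rewrite size_map.
- case: (enclose e) IHe => I s; case: (enclose f) IHf => J t /= sJ sI.
  by rewrite /zipop size_map size_zip sI sJ minnn.
- case: (enclose e) IHe => I s; case: (enclose f) IHf => J t /= sJ sI.
  by rewrite /zipop size_map size_zip !size_map sI sJ minnn.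
Qed.

Lemma nth_zipop f s t j : (j < size s)%N -> size s = size t ->
  nth (ipoint 0) (zipop f s t) j = f (nth (ipoint 0) s j) (nth (ipoint 0) t j).
Proof.
move=> js st; rewrite /zipop (nth_map (ipoint 0, ipoint 0)).
  by rewrite nth_zip.
by rewrite size_zip -st minnn.
Qed.

Definition in_cube u := forall j, `|u 0 j| <= 1.

Lemma enclose_value e u : in_cube u -> inI (eval (point u) e) (enclose e).1.
Proof.
move=> u1; elim: e => [i|z|e IH|e IHe f IHf|e IHe f IHf] /=.
- rewrite /inI /= ZRD ZRD ZRN /radius ZR_foldr -ler_distlC /point.
  rewrite opprD addrA subrr sub0r normrN.
  apply: le_trans (ler_norm_sum _ _ _) _; apply: ler_sum => j _.
  by rewrite normrM ZR_abs ler_piMr.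
- exact: inI_point.
- by case: (enclose e) IH => I s /= /inI_opp.
- case: (enclose e) IHe => I s; case: (enclose f) IHf => J t /= fJ eI.
  exact: inI_add.
- case: (enclose e) IHe => I s; case: (enclose f) IHf => J t /= fJ eI.
  exact: inI_mul.
Qed.

(** Differences obey an exact product rule, e(u)f(u) - e(w)f(w) = (e(u) - e(w)) f(u) + e(w) (f(u) -
    f(w)), so slopes propagate through products as derivatives do. *)
Lemma enclose_slope e u w : in_cube u -> in_cube w ->
  exists2 m : 'I_n -> R,
    forall j, inI (m j) (nth (ipoint 0) (enclose e).2 j) &
    eval (point u) e - eval (point w) e = \sum_j m j * (u 0 j - w 0 j).
Proof.
move=> u1 w1; elim: e => [i|z|e [m mI em]|e [m mI em] f [p pI fp]|
    e [m mI em] f [p pI fp]] /=.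
- exists (fun j => ZR R (coef i j)) => [j|].
    by rewrite nth_mkseq //; apply: inI_point.
  rewrite /point opprD addrACA subrr add0r -sumrB.
  by apply: eq_bigr => j _; rewrite mulrBr.
- exists (fun=> ZR R 0) => [j|].
    by rewrite nth_nseq ltn_ord; apply: inI_point.
  by rewrite subrr big1 // => j _; rewrite mul0r.
- exists (fun j => - m j) => [j|].
    have := mI j; have := size_enclose e.
    case: (enclose e) => I s /= sn mj.
    by rewrite (nth_map (ipoint 0)) ?sn //; apply: inI_opp.
  rewrite -opprD em -sumrN; by apply: eq_bigr => j _; rewrite mulNr.
- exists (fun j => m j + p j) => [j|].
    have := mI j; have := pI j; have := size_enclose e; have := size_enclose f.
    case: (enclose e) => I s; case: (enclose f) => J t /= tn sn pj mj.
    by rewrite nth_zipop ?sn ?tn //; apply: inI_add.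
  rewrite opprD addrACA em fp -big_split.
  by apply: eq_bigr => j _; rewrite /= mulrDl.
- exists (fun j => m j * eval (point u) f + eval (point w) e * p j) => [j|].
    have := mI j; have := pI j; have := size_enclose e; have := size_enclose f.
    have := enclose_value f u1; have := enclose_value e w1.
    case: (enclose e) => I s; case: (enclose f) => J t /= eI fJ tn sn pj mj.
    rewrite nth_zipop ?size_map ?sn ?tn // !(nth_map (ipoint 0)) ?sn ?tn //.
    by apply: inI_add; apply: inI_mul.
  transitivity ((eval (point u) e - eval (point w) e) * eval (point u) f +
      eval (point w) e * (eval (point u) f - eval (point w) f)); first by ring.
  rewrite em fp mulr_suml mulr_sumr -big_split.
  by apply: eq_bigr => j _ /=; ring.
Qed.

End Soundness.
End Certificate.

(** * Existence of a zero by the contraction principle *)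

Section Existence.
Variables (R : realType) (n : nat) (c : seq Z) (A : seq (seq Z)) (rho : Z).
Variable es : seq expr.
Hypothesis rho_gt0 : (0 < rho)%Z.
Hypothesis es_certified :
  all (fun k => certified n c A rho k (nth (Cst 0) es k)) (iota 0 n).

Local Notation point := (@point n c A R).
Local Notation r := (ZR R rho).

Let residual (u : 'rV[R]_n) (k : 'I_n) := eval (point u) (nth (Cst 0) es k).

(* Newton's method with A / rho as an approximate right inverse of the
   Jacobian, written in the parameter u. *)
Let step (u : 'rV[R]_n) : 'rV[R]_n := \row_k (u 0 k - residual u k / r).

Let r_gt0 : 0 < r.
Proof. by rewrite /ZR ltr0z; lia. Qed.

Let certP (k : 'I_n) : certified n c A rho k (nth (Cst 0) es k).
Proof. by apply: (allP es_certified); rewrite mem_iota add0n ltn_ord. Qed.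

Let norm_le_ubP (u : 'rV[R]_n) (b : R) : 0 <= b ->
  reflect (forall j, `|u 0 j| <= b) (`|u| <= b).
Proof.
move=> b0; rewrite [`|u|]mx_normrE; apply: (iffP (bigmax_leP _ _ _ _)).
  by case=> _ ub j; exact: (ub (0, j)).
by move=> ub; split=> // -[i j] _ /=; rewrite ord1.
Qed.

(** [step] has slope matrix I - M / [r], where M collects the slopes of the residuals; certification
    bounds the absolute row sums of [r] I - M by [r] / 2, hence the factor in the maximum norm. *)
Let step_contraction (u w : 'rV[R]_n) : `|u| <= 1 -> `|w| <= 1 ->
  `|step u - step w| <= 2^-1 * `|u - w|.
Proof.
move=> /norm_le_ubP-/(_ ler01) u1 /norm_le_ubP-/(_ ler01) w1.
apply/norm_le_ubP => [|k]; first by rewrite mulr_ge0 ?invr_ge0.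
have [m mI em] := enclose_slope c A (nth (Cst 0) es k) u1 w1.
have /andP[+ _] := certP k; set s := (enclose _ _ _ _).2 in mI *.
move=> /Z.leb_le /(@ZR_le R); rewrite ZRM ZR_foldr => row_le.
pose d (j : 'I_n) : R := ZR R (if j == k :> nat then rho else 0%Z).
have stepE : (step u - step w) 0 k =
    r^-1 * \sum_j (d j - m j) * (u 0 j - w 0 j).
  rewrite !mxE (eq_bigr _ (fun _ _ => mulrBl _ _ _)) sumrB -em.
  rewrite (bigD1 k) //= /d eqxx big1 ?addr0 => [|j jk].
    by rewrite -/(residual u k) -/(residual w k); field; rewrite gt_eqF.
  by rewrite (negbTE (jk : (j != k :> nat))) mul0r.
rewrite stepE normrM gtr0_norm ?invr_gt0 // ler_pdivrMl //.
apply: (@le_trans _ _ (\sum_j `|d j - m j| * `|u - w|)).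
  apply: le_trans (ler_norm_sum _ _ _) _; apply: ler_sum => j _.
  rewrite normrM ler_wpM2l //.
  by have /norm_le_ubP-/(_ (normr_ge0 _))/(_ j) := lexx `|u - w|; rewrite !mxE.
rewrite -mulr_suml mulrA ler_wpM2r // ler_pdivlMr ?ltr0n // mulrC.
apply: le_trans row_le; rewrite ler_wpM2l ?ler0n //.
apply: ler_sum => j _; rewrite distrC.
exact: inI_abs (inI_add (mI j) (inI_opp (inI_point _ _))).
Qed.

Let step0 : `|step 0| <= 2^-1.
Proof.
apply/norm_le_ubP => [|k]; first by rewrite invr_ge0.
have /andP[_ /Z.leb_le /(@ZR_le R)] := certP k.
rewrite ZRM ZR_abs -(eval_point0 n c A) -/(residual 0 k) => res_le.
rewrite !mxE sub0r normrN normrM normfV (gtr0_norm r_gt0).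
by rewrite ler_pdivrMr // -ler_pdivrMl ?invr_gt0 // invrK.
Qed.

Let ball : set 'rV[R]_n := closed_ball_ Num.norm 0 1.

Let ballE u : ball u = (`|u| <= 1).
Proof. by rewrite /ball /closed_ball_ /= sub0r normrN. Qed.

(** By contraction and [step0], |step u| <= |u| / 2 + 1 / 2 <= 1 on the unit ball. *)
Let step_ball : set_fun ball ball step.
Proof.
move=> u; rewrite !ballE => u1.
have -> : step u = (step u - step 0) + step 0 by rewrite subrK.
apply: le_trans (ler_normD _ _) _.
have := step_contraction u1 (_ : `|0| <= 1).
rewrite normr0 subr0 ler01 => /(_ isT).
move: step0; lra.
Qed.

(** A fixed point of [step] has all residuals zero, and the contraction principle provides one in
    the unit ball. *)
Lemma certified_zero : exists v : nat -> R,
  forall k, (k < n)%N -> eval v (nth (Cst 0) es k) = 0.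
Proof.
have [|||u _] := @banach_fixed_point R 'rV[R]_n ball (mkfun step_ball).
- exists 2^-1%:nng; split; first by rewrite /=; lra.
  by case=> u w [/= ]; rewrite !ballE; exact: step_contraction.
- exact: closed_closed_ball_.
- by exists 0; rewrite ballE normr0.
move=> /rowP uE; exists (point u) => k kn; move: (uE (Ordinal kn)); rewrite mxE.
move/eqP; rewrite eq_sym subr_eq addrC -subr_eq subrr eq_sym mulf_eq0.
by rewrite invr_eq0 (gt_eqF r_gt0) orbF => /eqP.
Qed.

End Existence.

(** * The polynomial system and its numerical certificate *)

Record qexpr := QExpr { ea : expr; eb : expr; ec : expr; ed : expr }.

Definition Sub (e f : expr) : expr := Add e (Opp f).
Definition qeadd (p q : qexpr) : qexpr :=
  QExpr (Add (ea p) (ea q)) (Add (eb p) (eb q))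
        (Add (ec p) (ec q)) (Add (ed p) (ed q)).
Definition qemul (p q : qexpr) : qexpr :=
  let m f g := Mul (f p) (g q) in
  QExpr (Sub (Sub (Sub (m ea ea) (m eb eb)) (m ec ec)) (m ed ed))
        (Sub (Add (Add (m ea eb) (m eb ea)) (m ec ed)) (m ed ec))
        (Add (Add (Sub (m ea ec) (m eb ed)) (m ec ea)) (m ed eb))
        (Add (Sub (Add (m ea ed) (m eb ec)) (m ec eb)) (m ed ea)).
Definition qeconj (p : qexpr) : qexpr :=
  QExpr (ea p) (Opp (eb p)) (Opp (ec p)) (Opp (ed p)).
Definition qenorm2 (p : qexpr) : expr :=
  let sq e := Mul e e in
  Add (Add (Add (sq (ea p)) (sq (eb p))) (sq (ec p))) (sq (ed p)).

(** Reducing the index modulo 3 lets [entry b (i + k)] stand for entry i of c^k y_b. *)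
Definition entry (a i : nat) : qexpr :=
  let x l := Var (12 * a + 4 * (i %% 3) + l) in
  QExpr (x 0) (x 1) (x 2) (x 3).

Definition hipE (a b k : nat) : qexpr :=
  let t i := qemul (qeconj (entry a i)) (entry b (i + k)) in
  qeadd (qeadd (t 0) (t 1)) (t 2).

Definition sqnormE (a : nat) : expr :=
  let t i := qenorm2 (entry a i) in Add (Add (t 0) (t 1)) (t 2).

Definition corrE (a : nat) : qexpr :=
  let t i := qemul (entry a i) (qeconj (entry a i.+1)) in
  qeadd (qeadd (t 0) (t 1)) (t 2).

(* The variables stand for [scale] times the coordinates, and every equation is
   homogenized to degree 4 so that all residuals have the same magnitude. *)
Definition scale : Z := 100000000.

Definition norm_eq (a : nat) : expr :=
  Mul (Cst (scale ^ 2)) (Sub (sqnormE a) (Cst (scale ^ 2))).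
Definition corr_sum : qexpr :=
  qeadd (qeadd (qeadd (corrE 0) (corrE 1)) (corrE 2)) (corrE 3).
Definition corr_eq (f : qexpr -> expr) : expr :=
  Mul (Cst (scale ^ 2)) (f corr_sum).
Definition pair_eq (abk : nat * nat * nat) : expr :=
  let: (a, b, k) := abk in
  Sub (Mul (Cst 11) (qenorm2 (hipE a b k))) (Cst (3 * scale ^ 4)).

(** Of the 22 triples (a, b, k) up to symmetry, the omitted ones are (3, 3, 1) and (c, 3, 0) for c <
    3; they are recovered from the condition on the C(y_a). *)
Definition listed_pairs : seq (nat * nat * nat) :=
  [:: (0, 0, 1); (1, 1, 1); (2, 2, 1);
      (0, 1, 0); (0, 1, 1); (0, 1, 2);
      (0, 2, 0); (0, 2, 1); (0, 2, 2);
      (1, 2, 0); (1, 2, 1); (1, 2, 2);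
      (0, 3, 1); (0, 3, 2); (1, 3, 1); (1, 3, 2); (2, 3, 1); (2, 3, 2)]%N.

Definition system : seq expr :=
  map norm_eq (iota 0 4) ++ map corr_eq [:: ea; eb; ec; ed] ++
  map pair_eq listed_pairs.

(* A numerical solution times [scale], and 500 times a right inverse of the
   Jacobian of the unscaled system.  The coordinates with an empty row are kept
   at 0: right multiplication of each y_a by a unit scalar makes its first entry
   real, and nine more zeros were found to be compatible with the system. *)
Definition center : seq Z := [::
  -43056073; 0; 0; 0; 37566988; 33241339; 15040926; 0; 72449309; 0; -12440962;
  0; -81811721; 0; 0; 0; 0; 0; -5995807; -21565954; 19990671; -14537943;
  46167532; -7961315; -38773530; 0; 0; 0; -34139558; -1295552; -53225207;
  -13050911; -41184263; -51283848; 0; 0; 60129186; 0; 0; 0; 8429323; 54293526;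
  0; -8261003; -29437141; 19545142; 45264097; 0]%Z.

Definition directions : seq (seq Z) := [::
  [::
    -961; -553; -840; -25; 233; -302; 165; -150; 37; 61; 30; 27; 29; 12; 42;
    57; 71; -19; 33; 52; 8; 7; -39; 2; -23; -8];
  [::];
  [::];
  [::];
  [::
    242; -47; -351; -28; -93; 155; 122; -33; -38; 1; 27; -21; -29; 20; 12; -2;
    11; 16; 17; 14; -14; 12; 10; -2; -1; 12];
  [::
    -428; -287; -344; 4; 114; -254; -41; 39; 53; 16; 11; 8; 17; 40; 7; 33; 24;
    -13; 7; 18; 8; -27; -26; 17; 1; -2];
  [::
    -441; -412; 215; -12; 373; -401; 189; -158; 54; 62; -53; 33; 30; 12; -10;
    33; -13; -26; 28; 36; 12; 17; -41; -12; -25; -22];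
  [::];
  [::
    -16; -115; -10; 7; 122; -156; -6; -42; 10; 19; -9; 21; 25; -16; 6; 15; 13;
    -14; 0; 7; 10; 1; -15; -1; -8; -10];
  [::];
  [::
    275; -163; 1130; 41; 374; -564; -118; 88; 23; 17; -109; 26; 40; 51; -69;
    14; -88; -35; -9; -7; 25; -37; -43; 7; 2; -27];
  [::];
  [::
    -38; -236; -145; 45; 50; -202; -103; 10; 19; -4; -9; 19; -16; 7; 17; 7; 4;
    28; -2; -8; 3; -28; -23; 3; 13; -1];
  [::];
  [::];
  [::];
  [::];
  [::];
  [::
    -41; 108; 167; -16; 34; -122; -64; 28; 9; -38; -20; 16; -1; 14; 6; 3; -14;
    11; -1; -18; 12; -16; -14; 23; -9; -1];
  [::
    -847; -1346; -1917; -182; -234; 407; 573; -89; -20; 108; 141; 32; 19; -14;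
    47; 45; 83; 15; 92; 97; -42; 33; 15; 28; -23; 50];
  [::
    -1058; -391; -787; -1; 133; -86; 116; -184; 40; 50; 45; 58; 5; 8; 51; 37;
    91; -26; 12; 39; 5; 30; -14; -18; -21; -12];
  [::
    641; 359; 99; -59; -199; 292; -58; 195; -48; -16; 38; -45; -33; -34; -37;
    -7; -5; -46; -15; -4; 0; -5; 37; 28; 1; 13];
  [::
    196; -270; -653; -46; -142; -38; 20; 129; -10; 16; 35; 11; -28; -3; 16;
    14; -4; 51; 30; 7; -11; -49; -15; 46; 13; 30];
  [::
    27; -350; 607; -117; -30; 100; 62; 47; -16; 27; -29; -2; 28; 20; -19; -9;
    -47; -17; 6; -24; 19; 12; 8; 46; -39; 4];
  [::
    139; -212; 106; -10; 50; -191; 77; 23; 8; 22; -34; 4; 13; 22; 0; -13; -30;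
    -11; 8; 18; -8; -30; -26; 15; 9; 12];
  [::];
  [::];
  [::];
  [::
    434; 526; 592; 59; -173; 211; -262; 89; -22; -59; -52; -17; -19; -24; -2;
    -3; -55; 11; -30; -47; 4; -3; 30; -10; 17; -4];
  [::
    -218; -408; -1877; -97; -338; 253; 608; -235; -33; 70; 133; -20; -19; -47;
    6; 67; 121; 17; 57; 83; -73; -6; -25; 13; 14; 75];
  [::
    -445; -764; -1723; -174; -233; 311; 506; -77; -28; 72; 146; 7; 8; -16; 15;
    40; 71; 20; 35; 76; -36; 15; 3; 41; -22; 51];
  [::
    -41; 707; 975; -13; 104; 234; -203; 283; -8; -68; -63; 5; -6; -2; 7; -41;
    -7; 12; -71; -106; 30; 37; 69; -14; -9; -40];
  [::
    -474; -9; 1486; 27; 498; -273; -394; 133; 49; -25; -148; 39; 29; 55; -2;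
    -53; -29; -17; -35; -51; 81; 46; 23; -15; -49; -86];
  [::
    464; 441; -567; 134; -98; -166; -56; -169; 1; -16; 41; -30; -28; -26; -15;
    22; 8; -10; 23; 5; -30; -37; -39; -32; 45; 18];
  [::];
  [::];
  [::
    624; 1055; 419; 26; -412; 94; -576; 157; -34; -113; 17; -57; -39; -17;
    -20; -13; -42; -4; -43; -70; 57; -1; -3; -1; 25; 29];
  [::];
  [::];
  [::];
  [::
    -672; 0; -205; -169; 159; 100; -210; -33; 32; -3; 3; 19; 13; -19; 28; 8;
    42; -21; -15; -5; 10; 77; 7; 1; -2; 2];
  [::
    -549; -433; -363; 137; 122; -40; 74; -251; 35; 20; -5; 37; 14; 0; 47; 13;
    24; 26; 26; 15; -24; 14; 28; -32; -15; 4];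
  [::];
  [::
    74; 181; -1385; 6; -561; 549; -36; -448; -37; -25; 133; -38; -54; -69; 59;
    14; 65; 20; 38; 39; -40; 11; 5; -15; 19; 59];
  [::
    -455; -234; 406; -465; 199; 125; -177; 81; 7; -21; -54; 35; 15; 33; 9;
    -32; -16; 25; -24; -35; 64; 43; 66; -8; 10; -4];
  [::
    1394; 1079; 1364; 633; 201; 471; -90; 155; -51; -22; -79; -47; -53; -58;
    -60; -56; -63; -59; -41; -39; -38; -27; -6; -9; -17; -12];
  [::
    -929; -1467; -661; -189; 311; -117; 632; 3; 18; 118; 7; 64; 56; 60; 7; 6;
    48; 24; 39; 77; 2; 11; 16; 35; 3; -30];
  [::]]%Z.

(** Degree 4 equations in scaled variables have Jacobian [scale]^3 times the unscaled one, and
    [directions] carries the factor 500; hence the modulus. *)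
Lemma system_certified :
  all (fun k => certified 26 center directions (500 * scale ^ 3) k
                  (nth (Cst 0) system k)) (iota 0 26).
Proof. by vm_compute. Qed.

(** * Quaternionic vectors and the cyclic shift *)

Section QuaternionicVectors.
Variable R : realType.
Implicit Types (p q : quat R) (x y : hvec R).

(** Re(conj(p) q), the Euclidean inner product of R^4. *)
Definition qdot p q : R :=
  qa p * qa q + qb p * qb q + qc p * qc q + qd p * qd q.
Definition sqnorm x : R := \sum_(i < 3) qnorm2 (x i).
Definition sqip x y : R := qnorm2 (hip x y).

Local Notation i0 := (inord 0 : 'I_3).
Local Notation i1 := (inord 1 : 'I_3).
Local Notation i2 := (inord 2 : 'I_3).

Definition corr x : quat R :=
  qadd (qadd (qmul (x i0) (qconj (x i1))) (qmul (x i1) (qconj (x i2))))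
       (qmul (x i2) (qconj (x i0))).

Lemma ord3E :
  [/\ lift ord0 (lift ord0 ord0) = i2, lift ord0 ord0 = i1 & ord0 = i0].
Proof. by split; apply: ord_inj; rewrite inordK. Qed.

Lemma sqnormE3 x : sqnorm x = qnorm2 (x i0) + qnorm2 (x i1) + qnorm2 (x i2).
Proof.
have [o2 o1 o0] := ord3E.
by rewrite /sqnorm !big_ord_recl big_ord0 o2 o1 o0 addr0 addrA.
Qed.

Lemma hipE3 x y : hip x y =
  qadd (qadd (qmul (qconj (x i0)) (y i0)) (qmul (qconj (x i1)) (y i1)))
       (qmul (qconj (x i2)) (y i2)).
Proof.
have [o2 o1 o0] := ord3E.
rewrite /hip !big_ord_recl big_ord0 o2 o1 o0 /qadd /qzero /=.
by rewrite !addr0 !addrA.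
Qed.

Lemma cycE x : (cyc x i0 = x i1) * (cyc x i1 = x i2) * (cyc x i2 = x i0).
Proof. by split; [split|]; rewrite /cyc inordK. Qed.

Lemma forall_ord3 (P : 'I_3 -> Prop) : P i0 -> P i1 -> P i2 -> forall i, P i.
Proof.
by move=> P0 P1 P2 [[|[|[|k]]] k3] //; rewrite -[Ordinal k3]inord_val.
Qed.

Lemma iter3_cyc x : iter 3 (@cyc R) x = x.
Proof. by apply/boolp.funext; apply: forall_ord3; rewrite /= !cycE. Qed.

Lemma iter_cyc_mod k x : iter k (@cyc R) x = iter (k %% 3) (@cyc R) x.
Proof.
rewrite {1}(divn_eq k 3) addnC iterD; congr iter.
by elim: (k %/ 3)%N => // m IH; rewrite mulSn iterD IH iter3_cyc.
Qed.

Lemma sqnorm_cyc x : sqnorm (cyc x) = sqnorm x.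
Proof. by rewrite !sqnormE3 !cycE; ring. Qed.

Lemma sqnorm_iter_cyc k x : sqnorm (iter k (@cyc R) x) = sqnorm x.
Proof. by elim: k => //= k IH; rewrite sqnorm_cyc. Qed.

Lemma sqip_cyc x y : sqip (cyc x) (cyc y) = sqip x y.
Proof. by rewrite /sqip !hipE3 !cycE /qnorm2 /=; ring. Qed.

Lemma sqip_iter_cyc k x y :
  sqip (iter k (@cyc R) x) (iter k (@cyc R) y) = sqip x y.
Proof. by elim: k => //= k IH; rewrite sqip_cyc. Qed.

Lemma sqipC x y : sqip x y = sqip y x.
Proof. by rewrite /sqip !hipE3 /qnorm2 /=; ring. Qed.

Lemma sqip_self x : sqip x x = sqnorm x ^+ 2.
Proof. by rewrite /sqip hipE3 sqnormE3 /qnorm2 /=; ring. Qed.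

(** Equality case of Cauchy-Schwarz: unit vectors on one line have [sqip] equal to 1, so the value 3
    / 11 separates points. *)
Lemma sqip_same_line x y : same_line x y -> sqip x y = sqnorm x * sqnorm y.
Proof. by case=> q xE; rewrite /sqip hipE3 !sqnormE3 !xE /qnorm2 /=; ring. Qed.

Lemma same_line_refl x : same_line x x.
Proof.
exists (Quat 1 0 0 0) => i; case: (x i) => a b c d; rewrite /qmul /=.
by rewrite !(mulr1, mulr0, subr0, addr0, add0r).
Qed.

(** Expand |<x, y>|^2 as the sum over i, j of Re(x_j conj(x_i) y_i conj(y_j)) and sum over the
    shifts of y: the terms with i = j give the product of the squared norms, those with j = i + 1
    and those with j = i - 1 each give Re(conj(C(x)) C(y)). *)
Lemma sum_sqip_cyc x y :
  sqip x y + sqip x (cyc y) + sqip x (cyc (cyc y)) =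
  sqnorm x * sqnorm y + 2 * qdot (corr x) (corr y).
Proof.
rewrite /sqip !hipE3 !sqnormE3 /corr /qdot !cycE.
case: (x i0) (x i1) (x i2) => [a0 b0 c0 d0] [a1 b1 c1 d1] [a2 b2 c2 d2].
case: (y i0) (y i1) (y i2) => [e0 f0 g0 h0] [e1 f1 g1 h1] [e2 f2 g2 h2].
by rewrite /qnorm2 /=; ring.
Qed.

End QuaternionicVectors.

(** * Inner products among the four orbits *)

Lemma listed_or_implied c d j : (c <= d)%N -> (d < 4)%N -> (j < 3)%N ->
  ~~ ((c == d) && (j == 0%N)) ->
  [|| (c, d, j) \in listed_pairs,
      [&& c < 3, d == 3 & j == 0],
      [&& c == d, j == 2 & (c, c, 1) \in listed_pairs]
    | [&& c == 3, d == 3 & (j == 1) || (j == 2)]]%N.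
Proof.
move=> cd d4; have := leq_ltn_trans cd d4; move: d4 cd.
by case: c d j => [|[|[|[|c]]]] [|[|[|[|d]]]] [|[|[|j]]].
Qed.

Section TwelvePoints.
Variables (R : realType) (y : nat -> hvec R) (s : R).

Local Notation G a b k := (sqip (y a) (iter k (@cyc R) (y b))).
Local Notation D a b := (qdot (corr (y a)) (corr (y b))).

Hypothesis sqnorm_y : forall a, (a < 4)%N -> sqnorm (y a) = s.
Hypothesis corr_y :
  qadd (qadd (qadd (corr (y 0)) (corr (y 1))) (corr (y 2))) (corr (y 3)) =
  qzero R.
Hypothesis listed_y : forall a b k, (a, b, k) \in listed_pairs ->
  11 * G a b k = 3 * s ^+ 2.

(** The shift preserves [sqip] and has order 3, so applying c^(3-k) to both arguments moves the
    shift to the other vector. *)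
Lemma gramC a b k : (k < 3)%N -> G b a k = G a b ((3 - k) %% 3)%N.
Proof.
move=> k3; rewrite -iter_cyc_mod sqipC -(sqip_iter_cyc (3 - k)) -iterD.
by rewrite subnK ?iter3_cyc // ltnW.
Qed.

Lemma sum_gram a b : (a < 4)%N -> (b < 4)%N ->
  G a b 0 + G a b 1 + G a b 2 = s ^+ 2 + 2 * D a b.
Proof. by move=> a4 b4; rewrite sum_sqip_cyc !sqnorm_y // expr2. Qed.

Lemma qdot_corr a :
  D a 0 + D a 1 + D a 2 + D a 3 = 0.
Proof.
transitivity (qdot (corr (y a)) (qzero R)); last by rewrite /qdot /=; ring.
by rewrite -corr_y /qdot /=; ring.
Qed.

(* The missing values follow from the relation on the [corr], which makes the
   four vectors [corr (y a)] a regular simplex centered at 0. *)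
Lemma gram a b k : (a < 4)%N -> (b < 4)%N -> (k < 3)%N ->
  ~~ ((a == b) && (k == 0%N)) -> 11 * G a b k = 3 * s ^+ 2.
Proof.
have dotC p q : qdot p q = qdot q p :> R by rewrite /qdot; ring.
have gram2 c : G c c 2 = G c c 1 by rewrite gramC.
have gram0 c : (c < 4)%N -> G c c 0 = s ^+ 2.
  by move=> c4; rewrite /= sqip_self sqnorm_y.
(* Here [sum_gram] reads s^2 + (6/11) s^2 = s^2 + 2 D c c; for c < d below it reads (9/11) s^2 = s^2
   + 2 D c d. *)
have dot_diag c : (c < 3)%N -> 22 * D c c = 6 * s ^+ 2.
  move=> c3; have c4 : (c < 4)%N by rewrite ltnW.
  have l : (c, c, 1%N) \in listed_pairs by case: c c3 {c4} => [|[|[|]]].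
  have := sum_gram c4 c4; rewrite gram2 gram0 //; have := listed_y l; lra.
have dot_off c d : (c < d)%N -> (d < 3)%N ->
    22 * D c d = - (2 * s ^+ 2).
  move=> cd d3; have d4 : (d < 4)%N by rewrite ltnW.
  have l j : (j < 3)%N -> (c, d, j) \in listed_pairs.
    by case: c d cd d3 {d4} j => [|[|[|c]]] [|[|[|d]]] // _ _ [|[|[|]]].
  have := sum_gram (ltn_trans cd d4) d4; move: (listed_y (l 0 isT)).
  have := listed_y (l 1 isT); have := listed_y (l 2 isT); lra.
(* Pairing C(y_c) with the vanishing sum leaves D c 3 = -(3 - 1 - 1) s^2 / 11. *)
have dot_last c : (c < 3)%N -> 22 * D c 3 = - (2 * s ^+ 2).
  move=> c3; have := qdot_corr c; have := dot_diag c c3.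
  case: c c3 => [|[|[|//]]] _.
  - have := dot_off 0%N 1%N isT isT; have := dot_off 0%N 2%N isT isT; lra.
  - have := dot_off 0%N 1%N isT isT; have := dot_off 1%N 2%N isT isT.
    rewrite (dotC (corr (y 1)) (corr (y 0))); lra.
  - have := dot_off 0%N 2%N isT isT; have := dot_off 1%N 2%N isT isT.
    rewrite (dotC (corr (y 2)) (corr (y 0))) (dotC (corr (y 2)) (corr (y 1))).
    lra.
have dot33 : 22 * D 3 3 = 6 * s ^+ 2.
  have := dot_last 0%N isT; have := dot_last 1%N isT; have := dot_last 2%N isT.
  have := qdot_corr 3; rewrite !(dotC (corr (y 3)) (corr (y _))); lra.
(* From here [sum_gram] is used backwards, recovering the omitted values from the [D]. *)
have gram33 : 11 * G 3 3 1 = 3 * s ^+ 2.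
  have := sum_gram (isT : (3 < 4)%N) (isT : (3 < 4)%N).
  rewrite gram2 gram0 //; lra.
have gram_last c : (c < 3)%N -> 11 * G c 3 0 = 3 * s ^+ 2.
  move=> c3; have := dot_last c c3; have c4 : (c < 4)%N by rewrite ltnW.
  have l j : (0 < j < 3)%N -> (c, 3%N, j) \in listed_pairs.
    by case: c c3 {c4} j => [|[|[|//]]] _ [|[|[|]]].
  have := sum_gram c4 (isT : (3 < 4)%N); have := listed_y (l 1%N isT).
  have := listed_y (l 2%N isT); lra.
(* For c <= d a triple is listed, is (c, 3, 0), is the mirror (c, c, 2) of a listed (c, c, 1), or
   lies in the orbit of y_3. *)
have gram_le c d j : (c <= d)%N -> (d < 4)%N -> (j < 3)%N ->
    ~~ ((c == d) && (j == 0%N)) -> 11 * G c d j = 3 * s ^+ 2.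
  move=> cd d4 j3 cdj; have := listed_or_implied cd d4 j3 cdj.
  case/or4P => [/listed_y //|/and3P[c3 /eqP-> /eqP->]|/and3P[/eqP<- /eqP-> l]|].
  - exact: gram_last.
  - by rewrite gram2; exact: listed_y.
  - by case/and3P=> /eqP-> /eqP-> /orP[]/eqP->; rewrite ?gram2.
move=> a4 b4 k3 abk; have [ab|ba] := leqP a b; first exact: gram_le.
rewrite gramC // gram_le ?(ltnW ba) ?ltn_pmod //.
by rewrite (ltn_eqF ba).
Qed.

Definition twelve (i : 'I_12) : hvec R := iter (i %% 3) (@cyc R) (y (i %/ 3)).

Lemma sqip_twelve i j : i != j -> 11 * sqip (twelve i) (twelve j) = 3 * s ^+ 2.
Proof.
(* Shifting both vectors by 3 - i mod 3 turns the first into its base vector [y (i %/ 3)]. *)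
move=> ij; rewrite /twelve -(sqip_iter_cyc (3 - i %% 3)) -!iterD.
have i3 : (i %% 3 < 3)%N by rewrite ltn_pmod.
have j3 : (j %% 3 < 3)%N by rewrite ltn_pmod.
rewrite subnK ?(ltnW i3) // iter3_cyc iter_cyc_mod.
apply: gram; rewrite ?ltn_pmod ?ltn_divLR //.
apply: contra ij => /andP[/eqP eqd /eqP eqm]; apply/eqP/val_inj => /=.
by rewrite (divn_eq i 3) (divn_eq j 3) eqd; congr addn; move: eqm; lia.
Qed.

Lemma sqnorm_twelve i : sqnorm (twelve i) = s.
Proof. by rewrite sqnorm_iter_cyc sqnorm_y // ltn_divLR. Qed.

Lemma cyc_twelve i : exists j, [/\ cyc (twelve i) = twelve j & i != j].
Proof.
(* The cyclic successor of [i] within its block of three indices. *)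
pose j := (3 * (i %/ 3) + (i %% 3).+1 %% 3)%N.
have j12 : (j < 12)%N by have := ltn_ord i; rewrite /j; lia.
exists (Ordinal j12); split.
  rewrite /twelve /= (_ : j %/ 3 = i %/ 3)%N; last by rewrite /j; lia.
  rewrite (_ : j %% 3 = (i %% 3).+1 %% 3)%N; last by rewrite /j; lia.
  by rewrite -(iter_cyc_mod (i %% 3).+1).
by apply/eqP => /(congr1 val) /=; rewrite /j; lia.
Qed.

End TwelvePoints.

(** * Rescaling, and reading a zero of the system as four vectors *)

Section Scaling.
Variables (R : realType) (c : R).

Definition hscale (x : hvec R) : hvec R := fun i =>
  let p := x i in Quat (c * qa p) (c * qb p) (c * qc p) (c * qd p).

Lemma sqnorm_hscale x : sqnorm (hscale x) = c ^+ 2 * sqnorm x.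
Proof. by rewrite !sqnormE3 /hscale /qnorm2 /=; ring. Qed.

Lemma sqip_hscale x y : sqip (hscale x) (hscale y) = c ^+ 4 * sqip x y.
Proof. by rewrite /sqip !hipE3 /hscale /qnorm2 /=; ring. Qed.

End Scaling.

Section RealSolution.
Variables (R : realType) (v : nat -> R).

Definition qeval (p : qexpr) : quat R :=
  Quat (eval v (ea p)) (eval v (eb p)) (eval v (ec p)) (eval v (ed p)).

Definition vec (a : nat) : hvec R := fun i => qeval (entry a i).

Lemma iter_cyc_vec k a (i : 'I_3) :
  iter k (@cyc R) (vec a) i = qeval (entry a (i + k)).
Proof.
elim: k i => [|k IH] i; first by rewrite addn0.
rewrite iterS {1}/cyc IH inordK ?ltn_pmod // /entry.
by have -> : ((i + 1) %% 3 + k = i + k.+1 %[mod 3])%N by rewrite modnDml -addnA.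
Qed.

Lemma sqnorm_vec a : sqnorm (vec a) = eval v (sqnormE a).
Proof. by rewrite sqnormE3 /vec !inordK. Qed.

Lemma sqip_vec a b k :
  sqip (vec a) (iter k (@cyc R) (vec b)) = eval v (qenorm2 (hipE a b k)).
Proof. by rewrite /sqip hipE3 !iter_cyc_vec /vec !inordK. Qed.

Lemma corr_vec a : corr (vec a) = qeval (corrE a).
Proof. by rewrite /corr /vec !inordK. Qed.

Hypothesis system_v :
  forall k, (k < 26)%N -> eval v (nth (Cst 0) system k) = 0.

Local Notation sigma := (ZR R scale).

Lemma sigma_neq0 : sigma != 0.
Proof. by rewrite /ZR intr_eq0. Qed.

Let sigma2E : ZR R (scale ^ 2) = sigma ^+ 2.
Proof. by rewrite Z.pow_2_r ZRM expr2. Qed.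

Lemma solution_norm a : (a < 4)%N -> sqnorm (vec a) = sigma ^+ 2.
Proof.
move=> a4; have : eval v (norm_eq a) = 0.
  have := system_v (ltn_trans a4 (isT : 4 < 26)%N).
  by case: a a4 => [|[|[|[|a]]]].
rewrite -[eval _ _]/(ZR R (scale ^ 2) *
  (eval v (sqnormE a) - ZR R (scale ^ 2))) -sqnorm_vec sigma2E.
move=> /eqP; rewrite mulf_eq0 expf_eq0 (negbTE sigma_neq0) /=.
by rewrite subr_eq0 => /eqP.
Qed.

Lemma solution_corr :
  qadd (qadd (qadd (corr (vec 0)) (corr (vec 1))) (corr (vec 2)))
    (corr (vec 3)) = qzero R.
Proof.
have comp f : eval v (corr_eq f) = 0 ->
    eval v (f corr_sum) = 0.
  rewrite -[eval v (corr_eq f)]/(ZR R (scale ^ 2) * eval v (f _)) sigma2E.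
  by move=> /eqP; rewrite mulf_eq0 expf_eq0 (negbTE sigma_neq0) => /eqP.
transitivity (qeval corr_sum).
  by rewrite !corr_vec.
rewrite /qeval (comp ea (@system_v 4 isT)) (comp eb (@system_v 5 isT)).
by rewrite (comp ec (@system_v 6 isT)) (comp ed (@system_v 7 isT)).
Qed.

Lemma solution_pair a b k : (a, b, k) \in listed_pairs ->
  11 * sqip (vec a) (iter k (@cyc R) (vec b)) = 3 * (sigma ^+ 2) ^+ 2.
Proof.
move=> l; have : eval v (pair_eq (a, b, k)) = 0.
  have j_lt : (index (a, b, k) listed_pairs < size listed_pairs)%N.
    by rewrite index_mem.
  (* The 4 norm equations and the 4 components of [corr_sum] precede the pair equations. *)
  have nthE j : nth (Cst 0) system (8 + j) =
    nth (Cst 0) (map pair_eq listed_pairs) j by [].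
  rewrite -{1}(nth_index (0, 0, 0)%N l) -(nth_map _ (Cst 0) _ j_lt) -nthE.
  by apply: system_v; rewrite -(ltn_add2l 8) in j_lt.
rewrite -[eval _ _]/(ZR R 11 * eval v (qenorm2 (hipE a b k)) -
  ZR R (3 * scale ^ 4)).
have ZR11 : ZR R 11 = 11 by [].
have ZR3 : ZR R 3 = 3 by [].
have scale4 : (scale ^ 4 = scale ^ 2 * scale ^ 2)%Z by [].
rewrite -sqip_vec ZR11 scale4 (ZRM _ 3) (ZRM _ (_ ^ _)) ZR3 sigma2E -expr2.
by move=> /eqP; rewrite subr_eq0 => /eqP.
Qed.

End RealSolution.

(** * Assembly of the simplex and its cyclic symmetry *)

Theorem theorem4p7 (R : realType) :
  (exists x : 'I_12 -> hvec R, tight_simplex x) /\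
  (exists x : 'I_12 -> hvec R, tight_simplex x /\ cyclic_symmetric x).
Proof.
suff [x xP] : exists x : 'I_12 -> hvec R, tight_simplex x /\ cyclic_symmetric x.
  by split; exists x; [case: xP|].
have neq1 : 3 / 11 <> 1 * 1 :> R by lra.
have [v system_v] := certified_zero R (erefl : (0 < 500 * scale ^ 3)%Z)
  system_certified.
have s0 := sigma_neq0 R.
have norm_v := solution_norm system_v; have corr_v := solution_corr system_v.
have pair_v a b k := @solution_pair R v system_v a b k.
(* The system was solved in coordinates multiplied by [scale]; dividing gives unit vectors. *)
pose x i := hscale (ZR R scale)^-1 (twelve (vec v) i).
have unit_x i : sqnorm (x i) = 1.
  by rewrite sqnorm_hscale (sqnorm_twelve norm_v) exprVn mulVf ?expf_neq0.
have sqip_x i j : i != j -> sqip (x i) (x j) = 3 / 11.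
  move=> ij; rewrite sqip_hscale.
  have := sqip_twelve norm_v corr_v pair_v ij => /(canRL (mulKf _)) ->.
    by move: (ZR R scale) s0 => sigma sigma0; field.
  by rewrite pnatr_eq0.
have distinct i j : i != j -> ~ same_line (x i) (x j).
  by move=> /sqip_x ij /sqip_same_line; rewrite ij !unit_x.
have cyc_x i : exists j, cyc (x i) = x j /\ i != j.
  by have [j [xj ij]] := cyc_twelve (vec v) i; exists j; rewrite /x -xj.
exists x; split; first split=> //.
  split=> // i j ij; rewrite -[qnorm2 _]/(sqip _ _) sqip_x //.
  by field.
move=> i; have [j [xj ij]] := cyc_x i; have [k [xk jk]] := cyc_x j.
(* If i = k, then c^2 fixes x_i, and so does c because c^3 = 1; this contradicts the distinctness of
   x_i and x_j. *)
have ik : i != k.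
  apply/eqP => eik; apply: (distinct _ _ ij); rewrite -[x i]iter3_cyc /=.
  by rewrite xj xk -eik xj; apply: same_line_refl.
rewrite xj xk; split; first by exists j; apply: same_line_refl.
split; first by exists k; apply: same_line_refl.
by do !split; apply: distinct.
Qed.
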